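(* Let $m\geq 5$ be an integer and let $\widetilde{\mathcal F}_m\subset[0,1]^2$ be the modified Fibonacci lattice defined in the context. Then every maximal interior box amidst $\widetilde{\mathcal F}_m$ has area $\varphi^{3-m}$, while every maximal exterior box amidst $\widetilde{\mathcal F}_m$ has area less than $\varphi^{3-m}$. In particular $\mathrm{disp}(\widetilde{\mathcal F}_m)=\varphi^{3-m}$ and $$\lim_{m\to\infty}|\widetilde{\mathcal F}_m|\,\mathrm{disp}(\widetilde{\mathcal F}_m)=\frac{\varphi^3}{\sqrt5}=1+\frac{2}{\sqrt5}.$$
   Context: Fibonacci numbers: $F_1=F_2=1$, $F_k=F_{k-1}+F_{k-2}$ for $k\ge 3$; $\varphi=\frac{1+\sqrt5}{2}$ is the golden ratio; $\{x\}$ denotes the fractional part of $x$. For fixed $m\ge 3$, let $\pi:\mathbb N_0\to\{0,1,\dots,F_m-1\}$ be $\pi(k)=F_m\{kF_{m-2}/F_m\}=kF_{m-2}\bmod F_m$ (an $F_m$-periodic map, a permutation on $\{0,\dots,F_m-1\}$). Let $s:\mathbb N_0\to\{1,\varphi\}$ be $s(i)=\varphi$ if $\pi(i)<\pi(i+1)$ and $s(i)=1$ otherwise. Let $L=\sum_{i=0}^{F_m-1}s(i)$ and $x_k=\sum_{i=0}^{k-1}s(i)$ for $k=0,\dots,F_m-1$. The modified Fibonacci lattice is $\widetilde{\mathcal F}_m=\{(x_k/L,\,x_{\pi(k)}/L): k=0,1,\dots,F_m-1\}$, a set with $F_m$ elements. Boxes are axis-parallel sets $[a_1,b_1)\times[a_2,b_2)\subseteq[0,1]^2$;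 the dispersion $\mathrm{disp}(\mathcal P)$ of a finite $\mathcal P\subset[0,1]^2$ is the supremum of the areas of such boxes containing no point of $\mathcal P$. A maximal empty box amidst $\mathcal P$ is one (containing no point of $\mathcal P$ in its interior) each of whose sides is bounded by an edge of the unit square or by a point of $\mathcal P$. A maximal interior box is an empty box each of whose four sides is bounded by a point of $\mathcal P$; a maximal exterior box is an empty box at least one side of which is bounded by an edge of the unit square and each of whose other sides is bounded by an edge of the unit square or a point of $\mathcal P$. *)

(* Defs.v *)
From HB Require Import structures.
From mathcomp Require Import all_boot all_order all_algebra.
From mathcomp Require Import finmap.
From mathcomp Require Import all_classical all_reals all_analysis.
Import Order.TTheory GRing.Theory Num.Theory.
Import numFieldNormedType.Exports.

Set Implicit Arguments.
Unset Strict Implicit.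
Unset Printing Implicit Defensive.

Local Open Scope classical_set_scope.
Local Open Scope ring_scope.

(* fib 1 = fib 2 = 1; the value fib 0 = 0 only extends the recurrence. *)
Fixpoint fib (n : nat) : nat :=
  match n with
  | 0 => 0
  | 1 => 1
  | (k.+1 as k').+1 => fib k' + fib k
  end%N.

Definition fib_perm (m k : nat) : nat := ((k * fib (m - 2)) %% fib m)%N.

Section Lattice.
Variable R : realType.

Definition golden : R := (1 + Num.sqrt 5) / 2.

Definition gap (m i : nat) : R :=
  if (fib_perm m i < fib_perm m i.+1)%N then golden else 1.

Definition lattice_length (m : nat) : R := \sum_(0 <= i < fib m) gap m i.

Definition coord (m k : nat) : R := \sum_(0 <= i < k) gap m i.

Definition lattice_point (m k : nat) : R * R :=
  (coord m k / lattice_length m, coord m (fib_perm m k) / lattice_length m).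

(* The construction is meant for 3 <= m; smaller m give junk values. *)
Definition mod_fib_lattice (m : nat) : {fset R * R} :=
  [fset lattice_point m k | k in iota 0 (fib m)]%fset.

End Lattice.

Record box (R : realType) := Box {
  left_ : R;
  right_ : R;
  bottom_ : R;
  top_ : R;
  box_lr : left_ < right_;
  box_bt : bottom_ < top_
}.

Section Boxes.
Variable R : realType.
Implicit Types (B : box R) (P : {fset R * R}).

Definition unit_square : set (R * R) := `[0, 1] `*` `[0, 1].

Definition box_set B : set (R * R) :=
  `[left_ B, right_ B[ `*` `[bottom_ B, top_ B[.

Definition box_interior B : set (R * R) :=
  `]left_ B, right_ B[ `*` `]bottom_ B, top_ B[.

Definition area B : R := (right_ B - left_ B) * (top_ B - bottom_ B).

Definition dispersion P : R :=
  sup [set area B | B in [set B | box_set B `<=` unit_square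
                                  /\ box_set B `&` [set` P] = set0]].

Definition empty_box P B : Prop :=
  box_set B `<=` unit_square /\ box_interior B `&` [set` P] = set0.

(* A point bounds a side when it lies in the relative interior of that side:
   a point at a corner does not prevent the side from being moved outwards. *)
Definition left_by_point P B : Prop :=
  exists2 p, p \in P & p.1 = left_ B /\ bottom_ B < p.2 < top_ B.

Definition right_by_point P B : Prop :=
  exists2 p, p \in P & p.1 = right_ B /\ bottom_ B < p.2 < top_ B.

Definition bottom_by_point P B : Prop :=
  exists2 p, p \in P & p.2 = bottom_ B /\ left_ B < p.1 < right_ B.

Definition top_by_point P B : Prop :=
  exists2 p, p \in P & p.2 = top_ B /\ left_ B < p.1 < right_ B.

Definition maximal_interior_box P B : Prop :=
  [/\ empty_box P B,
      left_by_point P B, right_by_point P B,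
      bottom_by_point P B & top_by_point P B].

Definition maximal_exterior_box P B : Prop :=
  [/\ empty_box P B,
      [\/ left_ B = 0, right_ B = 1, bottom_ B = 0 | top_ B = 1],
      left_ B = 0 \/ left_by_point P B,
      right_ B = 1 \/ right_by_point P B &
      (bottom_ B = 0 \/ bottom_by_point P B)
      /\ (top_ B = 1 \/ top_by_point P B)].

End Boxes.

(* Main.v *)
(* Up to the factor L = phi^(m-1), the points of the lattice other than the
   origin are (x, c - phi^(m-2) x') where x = a phi + b runs over the elements
   of Z[phi] for which this lies in the open square of side L, x' = a psi + b
   is the conjugate of x (psi = 1 - phi), and c is 0 for even m, 1/phi for odd
   m.  Here a and b count the gaps phi and 1 to the left of the point.
   Emptiness of a box thus becomes a question on pairs (x, x').  Multiplying by
   powers of the unit phi, one may assume that the x'-height h of the box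
   satisfies 1 < h <= phi; in such a strip consecutive points differ by 1, phi
   or phi^2, so an empty box has width at most phi^2 and area at most phi^3,
   with equality exactly when all four sides contain lattice points.  A side on
   the edge of the square contains no suitable point, because a nonzero element
   of Z[phi] satisfies |x x'| >= 1. *)

Require Import Defs.
From mathcomp Require Import all_boot all_order all_algebra.
From mathcomp Require Import finmap.
From mathcomp Require Import all_classical all_reals all_analysis.
From mathcomp Require Import ring lra zify.
Import Order.TTheory GRing.Theory Num.Theory.
Import numFieldNormedType.Exports.
Local Open Scope classical_set_scope.
Local Open Scope ring_scope.

Set Implicit Arguments.
Unset Strict Implicit.
Unset Printing Implicit Defensive.

(** * The ring Z[phi], its conjugation and its norm *)

Section GoldenIntegers.
Variable R : realType.
Local Notation phi := (golden R).
Local Notation psi := (1 - golden R).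

Lemma golden_sqr : phi ^+ 2 = phi + 1.
Proof.
have /sqr_sqrtr := ler0n R 5; rewrite /golden.
move: (Num.sqrt 5) => s; rewrite expr2 => hs; by field: hs.
Qed.

Lemma golden_gt32 : 3 / 2 < phi.
Proof.
rewrite /golden ltr_pM2r ?invr_gt0 //.
have : 2 < Num.sqrt (5 : R).
  have -> : 2 = Num.sqrt (2 ^+ 2) :> R by rewrite sqrtr_sqr ger0_norm.
  by rewrite ltr_sqrt; lra.
lra.
Qed.

Lemma golden_lt2 : phi < 2.
Proof. have := golden_sqr; have := golden_gt32; nra. Qed.

Lemma golden_gt0 : 0 < phi. Proof. have := golden_gt32; lra. Qed.

(** At [t = phi] this is an element x of Z[phi], at [t = psi] its conjugate x'. *)
Definition zphi (t : R) (a b : int) : R := a%:~R * t + b%:~R.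

Lemma zphiD t a b a' b' :
  zphi t (a + a') (b + b') = zphi t a b + zphi t a' b'.
Proof. by rewrite /zphi !intrD; ring. Qed.

Lemma zphiB t a b a' b' :
  zphi t (a - a') (b - b') = zphi t a b - zphi t a' b'.
Proof. by rewrite /zphi !intrB; ring. Qed.

Lemma zphi_mul t a b : t ^+ 2 = t + 1 -> zphi t (a + b) a = t * zphi t a b.
Proof. by rewrite /zphi intrD expr2 => ht; ring: ht. Qed.

Lemma psi_sqr : psi ^+ 2 = psi + 1.
Proof. by have := golden_sqr; rewrite !expr2 => h; ring: h. Qed.

Lemma zphi_norm a b :
  zphi phi a b * zphi psi a b = (b * b + a * b - a * a)%:~R.
Proof.
rewrite /zphi !(intrD, intrB, intrM, mulrNz).
by have := golden_sqr; rewrite expr2 => h; ring: h.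
Qed.

(** Four times the form is (2b + a)^2 - 5a^2; if it vanished with a nonzero, 5 would divide the two
    terms to powers of opposite parity. *)
Lemma norm_form_eq0 (a b : int) : b * b + a * b - a * a = 0 -> a = 0 /\ b = 0.
Proof.
move=> h.
have h5 : (2 * b + a) ^+ 2 = 5 * a ^+ 2 by move: h; rewrite !expr2; lia.
have [a0|a0] := eqVneq a 0.
  by split=> //; move: h; rewrite a0; nia.
exfalso.
have hn : (`|(2 * b + a)%R| ^ 2 = 5 * `|a| ^ 2)%N.
  by have := congr1 absz h5; rewrite abszM !abszX.
have := congr1 (logn 5) hn.
have apos : (0 < `|a|)%N by rewrite absz_gt0.
rewrite lognM // ?expn_gt0 ?apos // !lognX.
have -> : logn 5 5 = 1%N by [].
lia.
Qed.

Lemma zphi_norm_lt1 a b : `|zphi phi a b * zphi psi a b| < 1 -> a = 0 /\ b = 0.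
Proof.
rewrite zphi_norm -intr_norm -[1]/(1%:~R) ltr_int => h.
by apply: norm_form_eq0; lia.
Qed.

Lemma zphi_eq0 a b : zphi phi a b = 0 -> a = 0 /\ b = 0.
Proof. by move=> h; apply: zphi_norm_lt1; rewrite h mul0r normr0. Qed.

Lemma zphi_conj_eq0 a b : zphi psi a b = 0 -> a = 0 /\ b = 0.
Proof. by move=> h; apply: zphi_norm_lt1; rewrite h mulr0 normr0. Qed.

(** The difference x - x' = a(2 phi - 1) lies strictly between -phi and phi^2 + phi, so a is 0 or 1;
    the same bounds then confine b. *)
Lemma zphi_small a b :
  0 < zphi phi a b <= phi ^+ 2 -> `|zphi psi a b| < phi ->
  [\/ a = 0 /\ b = 1, a = 1 /\ b = 0 | a = 1 /\ b = 1].
Proof.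
have := golden_gt32; have := golden_lt2.
rewrite golden_sqr /zphi ltr_norml => g2 g1 /andP[x0 x1] /andP[y0 y1].
have a0 : (-1 < a)%R.
  rewrite ltNge; apply/negP => h.
  have {}h : (a%:~R : R) <= -1 by rewrite -[-1]/((-1)%:~R) ler_int.
  nra.
have a1 : (a < 2)%R.
  rewrite ltNge; apply/negP => h.
  have {}h : 2 <= (a%:~R : R) by rewrite -[2]/(2%:~R) ler_int.
  nra.
have [a_0|a_1] : a = 0 \/ a = 1 by lia.
  move: x0 x1 y0 y1; rewrite a_0 !mul0r !add0r => x0 x1 y0 y1.
  have b0 : (0 < b)%R by rewrite -(@ltr_int R).
  have b1 : (b < 2)%R by rewrite -(@ltr_int R); apply: lt_trans y1 _.
  by constructor 1; lia.
move: x0 x1 y0 y1; rewrite a_1 !mul1r => x0 x1 y0 y1.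
have b0 : (-1 < b)%R by rewrite -(@ltr_int R) -[(-1)%:~R]/(-1); lra.
have b1 : (b < 2)%R by rewrite -(@ltr_int R) -[2%:~R]/(2); lra.
have [b_0|b_1] : b = 0 \/ b = 1 by lia.
  by constructor 2.
by constructor 3.
Qed.

Lemma exists_natr_gt (x : R) : exists n : nat, x < n%:R.
Proof.
exists (Num.bound `|x|).
exact: le_lt_trans (ler_norm _) (archi_boundP (normr_ge0 _)).
Qed.

End GoldenIntegers.

(** * Empty boxes in the plane of pairs (x, x') *)

Section EmptyBoxes.
Variable R : realType.
Local Notation phi := (golden R).
Local Notation psi := (1 - golden R).

Definition zphi_empty (l r b t : R) : Prop := forall x y : int,
  l < zphi phi x y < r -> ~ (b < zphi psi x y < t).

Definition zphi_touched (l r b t : R) : Prop :=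
  [/\ exists x y, zphi phi x y = l /\ b < zphi psi x y < t,
      exists x y, zphi phi x y = r /\ b < zphi psi x y < t,
      exists x y, zphi psi x y = b /\ l < zphi phi x y < r
    & exists x y, zphi psi x y = t /\ l < zphi phi x y < r].

(** Height above 1 lets any first coefficient be completed to a point of the strip; the coefficient
    -N pushes x to the left. *)
Lemma zphi_strip (l b t : R) : 1 < t - b ->
  exists x y, zphi phi x y <= l /\ b < zphi psi x y < t.
Proof.
move=> h; have g := golden_gt32 R.
have [N hN] := exists_natr_gt (b + 1 - l).
have N0 : 0 <= N%:R :> R by [].
exists (- N%:Z), (Num.floor (b + N%:R * psi) + 1).
have := floor_itv (b + N%:R * psi).
rewrite /zphi mulrNz intrD -[N%:~R]/(N%:R : R) -[1%:~R]/(1 : R).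
move: (_%:~R) => f /andP[f1 f2]; split; last by apply/andP; split; nra.
by nra.
Qed.

(* In the strip b < x' < t, every point has a successor obtained by adding
   1, phi or phi^2 (conjugates 1, psi, psi + 1). *)
Lemma zphi_empty_wide (l r b t : R) : zphi_empty l r b t ->
  1 < t - b <= phi -> phi ^+ 2 <= r - l ->
  r = l + phi ^+ 2 /\
  exists x y, zphi phi x y = l /\ t - 1 <= zphi psi x y <= b + (phi - 1).
Proof.
move=> he /andP[h1 h2]; rewrite golden_sqr => w.
have g1 := golden_gt32 R; have g2 := golden_lt2 R.
have [x [y [xl xbt]]] := zphi_strip l h1.
have [N hN] := exists_natr_gt (l - zphi phi x y).
(* N bounds the distance from the point to l, and each successor is at least 1 further right. *)
elim: N x y xl xbt hN => [|N IH] x y xl /andP[xb xt].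
  by move=> ?; exfalso; lra.
rewrite -natr1 => hN.
(* A successor not beyond l is handled by induction; one beyond l must, by emptiness, lie at or
   beyond r. *)
have step a c : 1 <= zphi phi a c ->
    b < zphi psi x y + zphi psi a c < t ->
    l + (phi + 1) <= zphi phi x y + zphi phi a c \/
    (r = l + (phi + 1) /\
      exists x y, zphi phi x y = l /\ t - 1 <= zphi psi x y <= b + (phi - 1)).
  rewrite -!zphiD => a1 hs.
  have [xal|lxa] := lerP (zphi phi (x + a) (y + c)) l.
    right; apply: (IH _ _ xal hs); move: a1; rewrite zphiD; lra.
  left; case: (ltrP (zphi phi (x + a) (y + c)) r) => [xar|]; last lra.
  by case: (he (x + a) (y + c)) => //; rewrite lxa.
have e01 : zphi phi 0 1 = 1 /\ zphi psi 0 1 = 1 by rewrite /zphi; split; lra.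
have e10 : zphi phi 1 0 = phi /\ zphi psi 1 0 = psi by rewrite /zphi; split; lra.
have e11 : zphi phi 1 1 = phi + 1 /\ zphi psi 1 1 = psi + 1.
  by rewrite /zphi; split; lra.
(* For x' below t - 1 add 1, above b + (phi - 1) add phi, in between add phi^2. From x <= l the
   first two cannot reach l + phi^2. *)
have [x1|x1] := ltrP (zphi psi x y + 1) t.
  case: (step 0 1) => //; rewrite ?e01.1 ?e01.2; [lra| |lra].
  by apply/andP; split; lra.
have [x2|x2] := ltrP (b + (phi - 1)) (zphi psi x y).
  case: (step 1 0) => //; rewrite ?e10.1 ?e10.2; [lra| |lra].
  by apply/andP; split; lra.
case: (step 1 1) => //; rewrite ?e11.1 ?e11.2; [lra| |].
  by apply/andP; split; lra.
move=> x3.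
(* Here x = l, and x + phi^2 would lie inside the box if r exceeded l + phi^2. *)
case: (ltrP (l + (phi + 1)) r) => [rl|rl].
  case: (he (x + 1) (y + 1)); rewrite zphiD ?e11.1 ?e11.2.
    by apply/andP; split; lra.
  by apply/andP; split; lra.
split; first lra.
by exists x, y; split; [lra|apply/andP; split; lra].
Qed.

Definition zphi_extremal (l r b t : R) : Prop :=
  (r - l) * (t - b) <= phi ^+ 3 /\
  ((r - l) * (t - b) = phi ^+ 3 <-> zphi_touched l r b t).

Lemma zphi_extremal_normal (l r b t : R) : l < r -> 1 < t - b <= phi ->
  zphi_empty l r b t -> zphi_extremal l r b t.
Proof.
move=> lr hh he; have /andP[h1 h2] := hh.
have g1 := golden_gt32 R; have g2 := golden_lt2 R; have gs := golden_sqr R.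
have p0 : 0 < phi ^+ 2 by rewrite gs; lra.
have w : r - l <= phi ^+ 2.
  rewrite leNgt; apply/negP => w.
  have [rl _] := zphi_empty_wide he hh (ltW w).
  by move: w; rewrite rl addrC addKr ltxx.
split.
  by rewrite exprSr; apply: ler_pM => //; lra.
split=> [eqA|].
  have w' : phi ^+ 2 <= r - l.
    rewrite leNgt; apply/negP => w'.
    suff : (r - l) * (t - b) < phi ^+ 3 by rewrite eqA ltxx.
    rewrite exprSr; apply: lt_le_trans (_ : phi ^+ 2 * (t - b) <= _).
      by rewrite ltr_pM2r //; lra.
    by rewrite ler_pM2l.
  have [rl [x [y [xl /andP[y1 y2]]]]] := zphi_empty_wide he hh w'.
  have hphi : t - b = phi.
    apply: (mulfI (lt0r_neq0 p0)); rewrite -exprSr -eqA rl; congr (_ * _).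
    by rewrite addrAC subrr add0r.
  (* Height phi shrinks the band from t - 1 to b + (phi - 1) to one value; with x on the left side,
     x + phi^2, x + phi and x + 1 lie on the right, bottom and top sides. *)
  have yt : zphi psi x y = t - 1 by lra.
  split.
  - by exists x, y; split=> //; apply/andP; split; lra.
  - exists (x + 1), (y + 1); rewrite !zphiD /zphi -/(zphi phi x y).
    rewrite -/(zphi psi x y) xl yt rl gs !mul1r.
    by split; [lra|apply/andP; split; lra].
  - exists (x + 1), (y + 0); rewrite !zphiD xl yt /zphi !mul1r rl gs.
    by split; [lra|apply/andP; split; lra].
  - exists (x + 0), (y + 1); rewrite !zphiD xl yt /zphi !mul0r rl gs.
    by split; [lra|apply/andP; split; lra].
(* Conversely, the offsets of the other three side points from the left one all fall under
   [zphi_small]. *)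
case=> [[xl [yl [xl1 /andP[xl2 xl3]]]] [xr [yr [xr1 /andP[xr2 xr3]]]]].
move=> [xb [yb [xb1 /andP[xb2 xb3]]]] [xt [yt [xt1 /andP[xt2 xt3]]]].
have dr : [\/ xr - xl = 0 /\ yr - yl = 1, xr - xl = 1 /\ yr - yl = 0
            | xr - xl = 1 /\ yr - yl = 1].
  apply: zphi_small; rewrite !zphiB ?xr1 ?xl1; first by apply/andP; split; lra.
  by rewrite ltr_norml; apply/andP; split; lra.
have db : [\/ xb - xl = 0 /\ yb - yl = 1, xb - xl = 1 /\ yb - yl = 0
            | xb - xl = 1 /\ yb - yl = 1].
  apply: zphi_small; rewrite !zphiB ?xb1 ?xl1; first by apply/andP; split; lra.
  by rewrite ltr_norml; apply/andP; split; lra.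
have dt : [\/ xt - xl = 0 /\ yt - yl = 1, xt - xl = 1 /\ yt - yl = 0
            | xt - xl = 1 /\ yt - yl = 1].
  apply: zphi_small; rewrite !zphiB ?xt1 ?xl1; first by apply/andP; split; lra.
  by rewrite ltr_norml; apply/andP; split; lra.
have er : zphi phi (xr - xl) (yr - yl) = r - l by rewrite zphiB xr1 xl1.
have eb : zphi phi (xb - xl) (yb - yl) < r - l by rewrite zphiB xl1; lra.
have et : zphi phi (xt - xl) (yt - yl) < r - l by rewrite zphiB xl1; lra.
have eh : zphi psi (xt - xl) (yt - yl) - zphi psi (xb - xl) (yb - yl) = t - b.
  by rewrite !zphiB xb1 xt1; ring.
(* A height above 1 forces top offset 1 and bottom offset phi, since the conjugates of phi^2 and phi
   differ by exactly 1; then phi < r - l forces the right offset phi^2. *)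
have [erl etb] : r - l = phi ^+ 2 /\ t - b = phi.
  by case: dr er => -[-> ->]; case: db eb eh => -[-> ->];
     case: dt et => -[-> ->]; rewrite /zphi ?gs => *; split; lra.
by rewrite erl etb -exprSr.
Qed.

(* Multiplication by 1/phi in Z[phi] preserves areas and the set of points,
   while it exchanges the bottom and top sides since psi < 0. *)
Lemma zphi_extremal_scale (l r b t : R) :
  (zphi_empty l r b t -> zphi_extremal l r b t) ->
  zphi_empty (phi * l) (phi * r) (psi * t) (psi * b) ->
  zphi_extremal (phi * l) (phi * r) (psi * t) (psi * b).
Proof.
have g1 := golden_gt32 R; have g2 := golden_lt2 R; have gs := golden_sqr R.
have p0 : 0 < phi by lra.
have n0 : psi < 0 by lra.
have zm x y : zphi phi (x + y) x = phi * zphi phi x y.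
  exact: zphi_mul (golden_sqr R).
have zn x y : zphi psi (x + y) x = psi * zphi psi x y.
  exact: zphi_mul (psi_sqr R).
have area : (phi * r - phi * l) * (psi * b - psi * t) = (r - l) * (t - b).
  by move: gs; rewrite expr2 => e; ring: e.
(* Division by phi stays in Z[phi]: the pair (x, y) is phi times (y, x - y). *)
have inv (x y : int) : x = y + (x - y) by lia.
move=> H he.
have [] := H.
  move=> x y xlr ybt; case: (he (x + y) x); rewrite ?zm ?zn.
    by rewrite !ltr_pM2l.
  by rewrite !ltr_nM2l // andbC.
rewrite /zphi_extremal area => -> Ht; split=> //; rewrite Ht; split.
  case=> [[x1 [y1 [e1 h1]]] [x2 [y2 [e2 h2]]] [x3 [y3 [e3 h3]]] [x4 [y4 [e4 h4]]]].
  split.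
  - by exists (x1 + y1), x1; rewrite zm zn e1 !ltr_nM2l // andbC.
  - by exists (x2 + y2), x2; rewrite zm zn e2 !ltr_nM2l // andbC.
  - by exists (x4 + y4), x4; rewrite zm zn e4 !ltr_pM2l.
  - by exists (x3 + y3), x3; rewrite zm zn e3 !ltr_pM2l.
have pI := mulfI (lt0r_neq0 p0); have nI := mulfI (ltr0_neq0 n0).
case=> [[x1 [y1 [e1 h1]]] [x2 [y2 [e2 h2]]] [x3 [y3 [e3 h3]]] [x4 [y4 [e4 h4]]]].
rewrite (inv x1 y1) zm in e1; rewrite (inv x1 y1) zn !ltr_nM2l // in h1.
rewrite (inv x2 y2) zm in e2; rewrite (inv x2 y2) zn !ltr_nM2l // in h2.
rewrite (inv x3 y3) zn in e3; rewrite (inv x3 y3) zm !ltr_pM2l // in h3.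
rewrite (inv x4 y4) zn in e4; rewrite (inv x4 y4) zm !ltr_pM2l // in h4.
move/pI: e1 => e1; move/pI: e2 => e2; move/nI: e3 => e3; move/nI: e4 => e4.
split.
- by exists y1, (x1 - y1); rewrite andbC.
- by exists y2, (x2 - y2); rewrite andbC.
- by exists y4, (x4 - y4).
- by exists y3, (x3 - y3).
Qed.

(** Each division by phi multiplies the x'-height by phi, so a height at most phi reaches (1, phi]
    without overshooting. *)
Lemma zphi_emptyP (l r b t : R) : l < r -> b < t -> t - b <= phi ->
  zphi_empty l r b t -> zphi_extremal l r b t.
Proof.
have g1 := golden_gt32 R; have g2 := golden_lt2 R; have gs := golden_sqr R.
have p0 : 0 < phi by lra.
move=> lr bt h.
have [n] : exists n, 1 < phi ^+ n * (t - b).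
  have [N hN] := exists_natr_gt ((t - b)^-1 * 2).
  exists N; rewrite -ltr_pdivrMr ?subr_gt0 // div1r.
  have hB : N%:R / 2 < phi ^+ N.
    have : N%:R / 2 + 1 <= phi ^+ N; last lra.
    elim: (N) => [|k IH]; first by rewrite expr0; lra.
    by rewrite exprS -natr1; have : 0 <= k%:R :> R by []; nra.
  by apply: lt_trans hB; rewrite ltr_pdivlMr.
elim: n l r b t lr bt h => [|n IH] l r b t lr bt h hn.
  by apply: zphi_extremal_normal => //; rewrite h andbT; move: hn; rewrite expr0 mul1r.
have [h1|h1] := ltrP 1 (t - b); first by apply: zphi_extremal_normal; rewrite ?h1.
(* These encode 1/phi = phi - 1 and 1/psi = -phi. *)
have fi x : x = phi * ((phi - 1) * x) by move: gs; rewrite expr2 => e; ring: e.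
have ni x : x = psi * (- phi * x) by move: gs; rewrite expr2 => e; ring: e.
rewrite (fi l) (fi r) (ni b) (ni t); apply: zphi_extremal_scale; apply: IH.
- by rewrite ltr_pM2l //; lra.
- by rewrite ltr_nM2l //; lra.
- by rewrite -mulrBr mulNr -mulrN opprB; nra.
- by move: hn; rewrite exprSr -mulrA -mulrBr [- phi * _]mulNr -mulrN opprB.
Qed.

End EmptyBoxes.

(** * Fibonacci numbers and powers of phi and psi *)

Section Fibonacci.

Lemma fibSS n : fib n.+2 = (fib n.+1 + fib n)%N.
Proof. by []. Qed.

Lemma fib_gt0 n : (0 < fib n.+1)%N.
Proof. by elim: n => // n IH; rewrite fibSS addn_gt0 IH. Qed.

Lemma fib_cassini n : let u := (fib n.+1)%:Z in let v := (fib n)%:Z in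
  u ^+ 2 - u * v - v ^+ 2 = (-1) ^+ n.
Proof.
elim: n => [//|n IH]; cbv zeta in *; rewrite [RHS]exprS -IH fibSS PoszD; ring.
Qed.

Lemma fib_cassini_odd n :
  (fib n.+1)%:Z ^+ 2 - (fib n.+1)%:Z * (fib n)%:Z - (fib n)%:Z ^+ 2
    = (-1) ^+ (~~ odd n.+3).
Proof. by rewrite fib_cassini /= !negbK signr_odd. Qed.

Variables (T : comPzRingType) (t : T) (ht : t ^+ 2 = t + 1).

Lemma expr_fibS n : t ^+ n.+1 = (fib n.+1)%:R * t + (fib n)%:R.
Proof.
elim: n => [|n IH]; first by rewrite mul1r addr0.
by rewrite exprS IH fibSS natrD; move: ht; rewrite expr2 => h; ring: h.
Qed.

(** This is F_n t + F_(n-1) with F_(n-1) written as F_(n+1) - F_n, so that n = 0 is included. *)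
Lemma expr_fib n : t ^+ n = (fib n)%:R * (t - 1) + (fib n.+1)%:R.
Proof.
elim: n => [|n IH]; first by rewrite mul0r add0r.
by rewrite exprS IH fibSS natrD; move: ht; rewrite expr2 => h; ring: h.
Qed.

End Fibonacci.

(** * The permutation, with m = q + 3 *)

Section FibonacciPermutation.
Variable q : nat.
Local Notation perm := (fib_perm q.+3).
Local Notation F1 := (fib q.+1).
Local Notation F2 := (fib q.+2).
Local Notation F3 := (fib q.+3).

Lemma fib_permE k : perm k = (k * F1 %% F3)%N.
Proof. by rewrite /fib_perm subSS subSS subn0. Qed.

Lemma fib_perm0 : perm 0 = 0%N.
Proof. by rewrite fib_permE mul0n mod0n. Qed.

Lemma fib_perm_fib : perm F3 = 0%N.
Proof. by rewrite fib_permE modnMr. Qed.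

Lemma fib_perm_lt k : (perm k < F3)%N.
Proof. by rewrite fib_permE ltn_mod fib_gt0. Qed.

(** Modulo F_m, adding F_(m-2) is the same as subtracting F_(m-1). *)
Lemma fib_permS k : perm k.+1 =
  if (perm k + F1 < F3)%N then (perm k + F1)%N else (perm k - F2)%N.
Proof.
rewrite !fib_permE mulSn addnC -modnDml.
have := ltn_pmod (k * F1) (fib_gt0 q.+2); move: (_ %% _)%N => p hp.
have [h|h] := ltnP (p + F1) F3; first by rewrite modn_small.
have e : (p + F1 = p - F2 + F3)%N by move: h; rewrite [F3]fibSS; lia.
by rewrite e modnDr modn_small //; lia.
Qed.

Lemma fib_perm_ascent k : (perm k < perm k.+1)%N = (perm k + F1 < F3)%N.
Proof.
have := fib_gt0 q; have := fib_gt0 q.+1; have := fib_perm_lt k.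
rewrite fib_permS; case: ifP; lia.
Qed.

End FibonacciPermutation.

Lemma small_multiple (d n e : int) : d * n = e -> - n < e -> e < n -> d = 0.
Proof. by nia. Qed.

(* Here a2 f3 = j f2 + p while (a f0 - b f1) f3 = j f2 + k or j f2 - k by
   Cassini, so the two counts are determined modulo an error less than f3. *)
Lemma cassini_count (f0 f1 f2 f3 k j p a b a2 b2 : nat) (o : bool) :
  (f2 = f1 + f0)%N -> (f3 = f2 + f1)%N ->
  f1%:Z ^+ 2 - f1%:Z * f0%:Z - f0%:Z ^+ 2 = (-1) ^+ (~~ o) ->
  (0 < k < f3)%N -> (p < f3)%N ->
  (a + b = k)%N -> (a * f1 = j + b * f2)%N ->
  (a2 + b2 = j)%N -> (a2 * f1 = p + b2 * f2)%N ->
  a2%:Z = a%:Z * f0%:Z - b%:Z * f1%:Z + o%:Z.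
Proof.
move=> f2E f3E cas /andP[k0 kf] pf hk hj hj2 hp.
apply/eqP; rewrite -subr_eq0; apply/eqP.
have : (a2%:Z - (a%:Z * f0%:Z - b%:Z * f1%:Z)) * f3%:Z
   = p%:Z + k%:Z * (f1%:Z ^+ 2 - f1%:Z * f0%:Z - f0%:Z ^+ 2).
  have a2F : a2%:Z * f3%:Z = j%:Z * f2%:Z + p%:Z.
    by rewrite f3E -hj2 !PoszD mulrDl mulrDr; lia.
  have jE : j%:Z = a%:Z * f1%:Z - b%:Z * f2%:Z by lia.
  by rewrite mulrBl a2F jE -hk f3E f2E !PoszD; ring.
(* For [o] true the Cassini sign is +, and p + k, positive since k > 0, is brought into range by
   subtracting f3 once; this is the term [o]. *)
rewrite cas; case: o {cas} => /= h.
  by apply: (@small_multiple _ f3%:Z (p%:Z + k%:Z - f3%:Z)); lia.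
by apply: (@small_multiple _ f3%:Z (p%:Z - k%:Z)); lia.
Qed.

(** * Coordinates of the lattice points in Z[phi] *)

Section Coordinates.
Variables (R : realType) (q : nat).
Local Notation phi := (golden R).
Local Notation psi := (1 - golden R).
Local Notation perm := (fib_perm q.+3).
Local Notation coord := (Defs.coord R q.+3).
Local Notation F1 := (fib q.+1).
Local Notation F2 := (fib q.+2).
Local Notation F3 := (fib q.+3).

Lemma zphi_golden_expr n : zphi phi (fib n.+1) (fib n) = phi ^+ n.+1.
Proof. by rewrite (expr_fibS (golden_sqr R)). Qed.

Lemma zphi_conj_expr n : zphi psi (fib n.+1) (fib n) = psi ^+ n.+1.
Proof. by rewrite (expr_fibS (psi_sqr R)). Qed.

(* a and b count the gaps phi and 1 to the left of the k-th point. *)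
Lemma coord_spec k : exists a b : nat,
  [/\ (a + b = k)%N, (a * F1 = perm k + b * F2)%N & coord k = zphi phi a b].
Proof.
elim: k => [|k [a [b [abk h e]]]].
  exists 0%N, 0%N; split=> //; first by rewrite fib_perm0 !mul0n.
  by rewrite /Defs.coord big_geq // /zphi mul0r addr0.
have -> : coord k.+1 = coord k + gap R q.+3 k by rewrite /Defs.coord big_nat_recr.
rewrite /gap fib_perm_ascent fib_permS e.
have := fib_perm_lt q k; have F3E : (F3 = F2 + F1)%N by [].
move: (perm k) h => p h hp; case: ltnP => hlt.
  exists a.+1, b; split; [lia|lia|].
  by rewrite /zphi -!pmulrn -natr1; ring.
exists a, b.+1; split; [lia|lia|].
by rewrite /zphi -!pmulrn -natr1; ring.
Qed.

(** The permutation vanishes at F_m, so the gap counts satisfy a F_(m-2) = b F_(m-1) and a + b =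
    F_m, whence a = F_(m-1) and b = F_(m-2). *)
Lemma lattice_lengthE : lattice_length R q.+3 = phi ^+ q.+2.
Proof.
have [a [b [hab h e]]] := coord_spec F3.
rewrite /lattice_length -/(Defs.coord R q.+3 F3) e.
rewrite fib_perm_fib in h.
have F3E : (F3 = F2 + F1)%N by []; have F10 := fib_gt0 q; have F20 := fib_gt0 q.+1.
have aE : a = F2 by nia.
have bE : b = F1 by lia.
by rewrite aE bE zphi_golden_expr.
Qed.

Lemma ltr_coord k l : (k < l)%N -> coord k < coord l.
Proof.
elim: l => // l IH; rewrite ltnS leq_eqVlt => kl.
have -> : coord l.+1 = coord l + gap R q.+3 l by rewrite /Defs.coord big_nat_recr.
have g : 0 < gap R q.+3 l by rewrite /gap; case: ifP => // _; exact: golden_gt0.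
by case/orP: kl => [/eqP ->|/IH]; lra.
Qed.

Lemma coord0 : coord 0 = 0.
Proof. by rewrite /Defs.coord big_geq. Qed.

(* For odd m the points other than the origin lie on a translate of the
   lattice by 1/phi. *)
Definition shift : R := (odd q.+3)%:R * (phi - 1).

Lemma shift_bound : 0 <= shift <= phi - 1.
Proof.
have := golden_gt32 R; rewrite /shift; case: odd => h; first by rewrite mul1r; lra.
by rewrite mul0r; lra.
Qed.

(** By [cassini_count] the gap counts behind the ordinate are linear in those behind the abscissa,
    up to a parity term that becomes [shift]. *)
Lemma coord_perm (k a b : nat) : (0 < k < F3)%N -> (a + b = k)%N ->
  (a * F1 = perm k + b * F2)%N ->
  coord (perm k) = shift - phi ^+ q.+1 * zphi psi a b.
Proof.
move=> hkF hk ha.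
have [a2 [b2 [hj ha2 ->]]] := coord_spec (perm k).
have p2lt := fib_perm_lt q (perm k).
have a2E := cassini_count (erefl F2) (erefl F3) (fib_cassini_odd q) hkF p2lt hk ha hj ha2.
have jE : (perm k)%:~R = a%:~R * F1%:~R - b%:~R * F2%:~R :> R.
  by rewrite -!intrM -intrB; congr (_%:~R); lia.
have b2E : b2%:~R = (perm k)%:~R - a2%:~R :> R by rewrite -hj PoszD intrD; ring.
rewrite /zphi b2E jE a2E !(intrD, intrB, intrM) /shift.
have -> : phi ^+ q.+1 * (a%:~R * psi + b%:~R) = b%:~R * phi ^+ q.+1 - a%:~R * phi ^+ q.
  by rewrite exprS; have := golden_sqr R; rewrite expr2 => e; ring: e.
rewrite !(expr_fib (golden_sqr R)) -!pmulrn; ring.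
Qed.

End Coordinates.

(** * Which elements of Z[phi] are lattice points *)

Section LatticePoints.
Variables (R : realType) (q : nat).
Local Notation phi := (golden R).
Local Notation psi := (1 - golden R).
Local Notation perm := (fib_perm q.+3).
Local Notation coord := (Defs.coord R q.+3).
Local Notation F1 := (fib q.+1).
Local Notation F2 := (fib q.+2).
Local Notation F3 := (fib q.+3).
Local Notation shift := (shift R q).

(** Here a >= 1 and b <= -a, so x' <= a(psi - 1) = -a phi. *)
Lemma zphi_conj_le (a b : int) : 0 < zphi phi a b -> a + b <= 0 ->
  zphi psi a b <= - phi.
Proof.
have g := golden_gt32 R; rewrite /zphi => h ab.
have {ab} ab : a%:~R + b%:~R <= 0 :> R by rewrite -intrD -[0]/(0%:~R) ler_int.
have a1 : 1 <= a.
  rewrite leNgt; apply/negP => a0.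
  have : a%:~R <= 0 :> R by rewrite -[0]/(0%:~R) ler_int; lia.
  by nra.
have {}a1 : 1 <= a%:~R :> R by rewrite -[1]/(1%:~R) ler_int.
by nra.
Qed.

(** The sum a + b is the index of the prospective point. The upper bound is the lower one for the
    reflection phi^(n+2) - x. *)
Lemma zphi_index_bound n (a b : int) :
  0 < zphi phi a b < phi ^+ n.+2 -> - phi < zphi psi a b < 0 ->
  0 < a + b < (fib n.+3)%:Z.
Proof.
have g := golden_gt32 R; have g' := golden_lt2 R.
move=> /andP[x0 x1] /andP[y0 y1]; apply/andP; split; rewrite ltNge; apply/negP => h.
  by have := zphi_conj_le x0 h; lra.
have : zphi psi ((fib n.+2)%:Z - a) ((fib n.+1)%:Z - b) <= - phi.
  apply: zphi_conj_le; first by rewrite zphiB zphi_golden_expr subr_gt0.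
  by move: h; rewrite [fib n.+3]fibSS PoszD; lia.
rewrite zphiB zphi_conj_expr.
have : `|psi ^+ n.+2| <= 1.
  by rewrite normrX exprn_ile1 // ler_norml; apply/andP; split; lra.
by rewrite ler_norml => /andP[]; lra.
Qed.

Lemma conj_golden_expr n : phi ^+ n * psi ^+ n = (-1) ^+ n.
Proof.
rewrite -exprMn; congr (_ ^+ _).
by have := golden_sqr R; rewrite expr2 => e; ring: e.
Qed.

(** A point this low would have |x x'| < phi (phi - 1) = 1 and hence be 0, against x > 0. *)
Lemma zphi_low (a b : int) : 0 < zphi phi a b < phi ^+ q.+2 ->
  ~ 0 <= shift - phi ^+ q.+1 * zphi psi a b < phi - 1.
Proof.
move=> /andP[x0 x1] /andP[y0 y1].
have /andP[s0 s1] := shift_bound R q; have g := golden_gt32 R.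
have P0 : 0 < phi ^+ q.+1 by apply: exprn_gt0; lra.
suff [a0 b0] : a = 0 /\ b = 0 by move: x0; rewrite a0 b0 /zphi mul0r addr0 ltxx.
apply: (@zphi_norm_lt1 R); rewrite normrM (gtr0_norm x0).
have h : phi ^+ q.+1 * `|zphi psi a b| <= phi - 1.
  by rewrite -{1}(gtr0_norm P0) -normrM ler_norml; apply/andP; split; lra.
have [z0|z0] := eqVneq (zphi psi a b) 0; first by rewrite z0 normr0 mulr0.
apply: lt_le_trans (_ : phi ^+ q.+2 * `|zphi psi a b| <= _).
  by rewrite ltr_pM2r // normr_gt0.
rewrite exprS -mulrA; apply: le_trans (_ : phi * (phi - 1) <= _).
  by rewrite ler_pM2l //; lra.
by rewrite mulrBr -expr2 golden_sqr; lra.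
Qed.

Lemma zphi_conj_range (a b : int) : 0 < zphi phi a b < phi ^+ q.+2 ->
  0 < shift - phi ^+ q.+1 * zphi psi a b < phi ^+ q.+2 ->
  - phi < zphi psi a b < 0.
Proof.
move=> hx /andP[y0 y1].
have /andP[s0 s1] := shift_bound R q; have g := golden_gt32 R.
have P0 : 0 < phi ^+ q.+1 by apply: exprn_gt0; lra.
apply/andP; split.
  by rewrite -(ltr_pM2l P0) mulrN -exprSr; lra.
rewrite ltNge; apply/negP => z0; apply: (zphi_low hx).
apply/andP; split; first exact: ltW.
have [z1|z1] := eqVneq (zphi psi a b) 0.
  have [a0 b0] := zphi_conj_eq0 z1.
  by move: hx; rewrite a0 b0 /zphi mul0r addr0 ltxx.
have : 0 < phi ^+ q.+1 * zphi psi a b.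
  by apply: mulr_gt0 => //; rewrite lt_def z1.
lra.
Qed.

(** The converse of [coord_perm]: a + b is the index, and j = a F_(m-2) - b F_(m-1) must be its
    image under the permutation. *)
Lemma zphi_in_lattice (a b : int) : 0 < zphi phi a b < phi ^+ q.+2 ->
  0 < shift - phi ^+ q.+1 * zphi psi a b < phi ^+ q.+2 ->
  exists k, [/\ (0 < k < F3)%N, coord k = zphi phi a b &
    coord (perm k) = shift - phi ^+ q.+1 * zphi psi a b].
Proof.
move=> hx hy.
have hx' := zphi_conj_range hx hy.
have hk := zphi_index_bound hx hx'.
pose o : int := (odd q.+3)%:Z.
pose j := a * F1%:Z - b * F2%:Z.
pose a2 := a * (fib q)%:Z - b * F1%:Z + o; pose b2 := j - a2.
have oR : o%:~R = (odd q.+3)%:R :> R by [].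
have jR : j%:~R = a%:~R * F1%:R - b%:~R * F2%:R :> R by rewrite intrB !intrM.
have a2R : a2%:~R = a%:~R * (fib q)%:R - b%:~R * F1%:R + (odd q.+3)%:R :> R.
  by rewrite intrD intrB !intrM.
have b2R : b2%:~R = j%:~R - a2%:~R :> R by rewrite intrB.
have yE : zphi phi a2 b2 = shift - phi ^+ q.+1 * zphi psi a b.
  rewrite /zphi b2R jR a2R /shift.
  have -> : phi ^+ q.+1 * (a%:~R * psi + b%:~R) = b%:~R * phi ^+ q.+1 - a%:~R * phi ^+ q.
    by rewrite exprS; have := golden_sqr R; rewrite expr2 => e; ring: e.
  by rewrite !(expr_fib (golden_sqr R)); ring.
have yE' : zphi psi a2 b2 = - psi ^+ q.+1 * zphi phi a b - (odd q.+3)%:R * phi.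
  rewrite /zphi b2R jR a2R.
  have -> : - psi ^+ q.+1 * (a%:~R * phi + b%:~R) = a%:~R * psi ^+ q - b%:~R * psi ^+ q.+1.
    by rewrite exprS; have := golden_sqr R; rewrite expr2 => e; ring: e.
  by rewrite !(expr_fib (psi_sqr R)); ring.
have P0 : 0 < phi ^+ q.+1 by apply: exprn_gt0; exact: golden_gt0.
(* The ordinate is itself in Z[phi]; its conjugate is -z or z - phi with 0 < z < phi, so the index
   bound applies to j as well. *)
have hj : 0 < a2 + b2 < F3%:Z.
  apply: zphi_index_bound; first by rewrite yE.
  have xP : 0 < zphi phi a b / phi ^+ q.+1 < phi.
    case/andP: hx => x0 x1; rewrite divr_gt0 //=.
    by rewrite ltr_pdivrMr // -exprS.
  have psiE : psi ^+ q.+1 = (-1) ^+ q.+1 / phi ^+ q.+1.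
    by rewrite -conj_golden_expr [phi ^+ _ * _]mulrC mulfK // lt0r_neq0.
  move: xP; rewrite yE' psiE mulNr mulrAC -mulrA -signr_odd /= negbK.
  move: (_ / _) => z /andP[z0 z1].
  by case: (odd q); rewrite /= ?expr0 ?expr1; apply/andP; split; lra.
have jE : a2 + b2 = j by rewrite /b2; lia.
rewrite jE in hj.
have [k kE] : exists k : nat, a + b = k%:Z by exists (absz (a + b)); lia.
have kF : (0 < k < F3)%N by rewrite kE in hk.
have [ak [bk [abk h e]]] := coord_spec R q k.
(* The multiple (ak - a) F_m equals [perm k - j], which is below F_m in absolute value. *)
have aE : ak%:Z = a.
  have F3E : F3%:Z = F2%:Z + F1%:Z by rewrite [F3]fibSS PoszD.
  have p3 := fib_perm_lt q k.
  apply/eqP; rewrite -subr_eq0; apply/eqP.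
  apply: (@small_multiple _ F3%:Z ((perm k)%:Z - j)); last 2 first.
  - by move: (perm k) p3 => p; move: hj; lia.
  - by move: (perm k) p3 => p; move: hj; lia.
  have -> : (perm k)%:Z = ak%:Z * F1%:Z - bk%:Z * F2%:Z.
    by rewrite -!PoszM h PoszD addrK.
  have -> : bk%:Z = k%:Z - ak%:Z by lia.
  rewrite F3E /j.
  have -> : b = k%:Z - a by lia.
  by ring.
have bE : bk%:Z = b by lia.
exists k; split=> //; first by rewrite e aE bE.
by rewrite (coord_perm R kF abk h) aE bE.
Qed.

Lemma mem_mod_fib_lattice (p : R * R) : p \in mod_fib_lattice R q.+3 ->
  exists2 k, (k < F3)%N &
    p.1 * phi ^+ q.+2 = coord k /\ p.2 * phi ^+ q.+2 = coord (perm k).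
Proof.
have L0 : phi ^+ q.+2 != 0 by rewrite lt0r_neq0 // exprn_gt0 // golden_gt0.
case/imfsetP => k /=; rewrite mem_iota add0n => kF ->.
by exists k => //; rewrite /lattice_point lattice_lengthE /= !divfK.
Qed.

(** A positive coordinate excludes the origin, where the formula fails for odd m. *)
Lemma mem_mod_fib_lattice_zphi (p : R * R) : p \in mod_fib_lattice R q.+3 ->
  0 < p.1 \/ 0 < p.2 ->
  exists a b, p.1 * phi ^+ q.+2 = zphi phi a b /\
    p.2 * phi ^+ q.+2 = shift - phi ^+ q.+1 * zphi psi a b.
Proof.
move=> /mem_mod_fib_lattice[k kF [e1 e2]] p0.
have L0 : 0 < phi ^+ q.+2 by rewrite exprn_gt0 // golden_gt0.
have k0 : (0 < k)%N.
  rewrite lt0n; apply/eqP => k0; move: e1 e2; rewrite k0 fib_perm0 coord0.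
  by case: p0 => p0 e1 e2; [have := mulr_gt0 p0 L0; rewrite e1 ltxx
                           |have := mulr_gt0 p0 L0; rewrite e2 ltxx].
have [a [b [abk h e]]] := coord_spec R q k.
by exists a, b; rewrite e1 e2 (coord_perm R _ abk h) ?k0.
Qed.

End LatticePoints.

(** * Areas of empty boxes *)

Section BoxesInLattice.
Variables (R : realType) (q : nat).
Local Notation phi := (golden R).
Local Notation psi := (1 - golden R).
Local Notation F1 := (fib q.+1).
Local Notation F2 := (fib q.+2).
Local Notation shift := (shift R q).
Local Notation L := (phi ^+ q.+2).
Local Notation P := (phi ^+ q.+1).
Local Notation lattice := (mod_fib_lattice R q.+3).
Implicit Type B : box R.

Let phi0 : 0 < phi := golden_gt0 R.
Let P0 : 0 < P := exprn_gt0 _ phi0.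
Let L0 : 0 < L := exprn_gt0 _ phi0.
Let LE : L = phi * P := exprS _ _.

Lemma box_set_in_square B : box_set B `<=` @unit_square R <->
  [/\ 0 <= left_ B, right_ B <= 1, 0 <= bottom_ B & top_ B <= 1].
Proof.
have lr := box_lr B; have bt := box_bt B; split; last first.
  move=> [l0 r1 b0 t1] [x y] [] /=; rewrite !in_itv /= => /andP[x0 x1] /andP[y0 y1].
  by split=> /=; rewrite in_itv /=; apply/andP; split; lra.
move=> sub.
have inB x y : left_ B <= x < right_ B -> bottom_ B <= y < top_ B ->
    0 <= x <= 1 /\ 0 <= y <= 1.
  move=> hx hy; have [] := sub (x, y).
    by split; rewrite /= in_itv.
  by rewrite /= !in_itv.
have [/andP[l0 l1] /andP[b0 b1]] : 0 <= left_ B <= 1 /\ 0 <= bottom_ B <= 1.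
  by apply: inB; rewrite lexx.
split=> //; rewrite leNgt; apply/negP => h.
  have [/andP[_ +] _] : 0 <= (1 + right_ B) / 2 <= 1 /\ 0 <= bottom_ B <= 1.
    by apply: inB; apply/andP; split; lra.
  lra.
have [_ /andP[_ +]] : 0 <= left_ B <= 1 /\ 0 <= (1 + top_ B) / 2 <= 1.
  by apply: inB; apply/andP; split; lra.
lra.
Qed.

(** The box in the plane of pairs (x, x'). The ordinate [shift - P * x'] decreases in x', so top and
    bottom are exchanged. *)
Definition zphi_left B := left_ B * L.
Definition zphi_right B := right_ B * L.
Definition zphi_bottom B := (shift - top_ B * L) / P.
Definition zphi_top B := (shift - bottom_ B * L) / P.

Lemma zphi_bottom_lt B x :
  (zphi_bottom B < x) = (shift - P * x < top_ B * L).
Proof. by rewrite /zphi_bottom ltr_pdivrMr //; apply/idP/idP; lra. Qed.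

Lemma zphi_top_gt B x :
  (x < zphi_top B) = (bottom_ B * L < shift - P * x).
Proof. by rewrite /zphi_top ltr_pdivlMr //; apply/idP/idP; lra. Qed.

Lemma zphi_bottom_eq B x : (x = zphi_bottom B) <-> (shift - P * x = top_ B * L).
Proof.
rewrite /zphi_bottom; split=> [->|<-].
  by rewrite mulrC divfK ?lt0r_neq0 //; ring.
by apply: (mulfI (lt0r_neq0 P0)); rewrite [RHS]mulrC divfK ?lt0r_neq0 //; ring.
Qed.

Lemma zphi_top_eq B x : (x = zphi_top B) <-> (shift - P * x = bottom_ B * L).
Proof.
rewrite /zphi_top; split=> [->|<-].
  by rewrite mulrC divfK ?lt0r_neq0 //; ring.
by apply: (mulfI (lt0r_neq0 P0)); rewrite [RHS]mulrC divfK ?lt0r_neq0 //; ring.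
Qed.

Lemma lattice_box_empty B : empty_box lattice B ->
  zphi_empty (zphi_left B) (zphi_right B) (zphi_bottom B) (zphi_top B).
Proof.
move=> [/box_set_in_square[l0 r1 b0 t1] he] a b.
rewrite /zphi_left /zphi_right zphi_bottom_lt zphi_top_gt.
move=> /andP[x0 x1] /andP[y1 y0].
have [||k [/andP[k0 kF] e1 e2]] := @zphi_in_lattice R q a b.
- apply/andP; split; first by apply: le_lt_trans x0; rewrite mulr_ge0 // ltW.
  by apply: lt_le_trans x1 _; rewrite ler_piMl // ltW.
- apply/andP; split; first by apply: le_lt_trans y0; rewrite mulr_ge0 // ltW.
  by apply: lt_le_trans y1 _; rewrite ler_piMl // ltW.
suff : (box_interior B `&` [set` lattice]) (lattice_point R q.+3 k) by rewrite he.
split; last by apply/imfsetP; exists k; rewrite //= mem_iota.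
rewrite /lattice_point lattice_lengthE e1 e2; split; rewrite /= in_itv /=.
  by rewrite ltr_pdivlMr // ltr_pdivrMr // x0 x1.
by rewrite ltr_pdivlMr // ltr_pdivrMr // y0 y1.
Qed.

(** Since L / P = phi, a box in the unit square has x'-height at most phi, as [zphi_emptyP]
    demands. *)
Lemma zphi_height B : zphi_top B - zphi_bottom B = phi * (top_ B - bottom_ B).
Proof.
rewrite /zphi_top /zphi_bottom -mulrBl.
have -> : shift - bottom_ B * L - (shift - top_ B * L) = phi * (top_ B - bottom_ B) * P.
  by rewrite LE; ring.
by rewrite mulfK // lt0r_neq0.
Qed.

Lemma zphi_area B : (zphi_right B - zphi_left B) * (zphi_top B - zphi_bottom B) =
  phi ^+ q.+3 * area B.
Proof. by rewrite zphi_height /zphi_right /zphi_left /area [phi ^+ q.+3]exprS; ring. Qed.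

(** Areas scale by phi^(q+3), which turns the bound phi^3 into phi^(-q) = phi^(3-m). *)
Lemma empty_box_area B : empty_box lattice B ->
  area B <= phi ^- q /\ (area B = phi ^- q <->
    zphi_touched (zphi_left B) (zphi_right B) (zphi_bottom B) (zphi_top B)).
Proof.
move=> he; have [/box_set_in_square[l0 r1 b0 t1] _] := he.
have lr := box_lr B; have bt := box_bt B.
have [] := zphi_emptyP _ _ _ (lattice_box_empty he).
- by rewrite /zphi_left /zphi_right ltr_pM2r.
- by rewrite -subr_gt0 zphi_height; apply: mulr_gt0; rewrite // subr_gt0.
- by rewrite zphi_height; apply: ler_piMr; [exact: ltW|lra].
have q0 : 0 < phi ^+ q by apply: exprn_gt0.
rewrite zphi_area -[q.+3]/(3 + q)%N exprD -mulrA => hle hiff; split.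
  by rewrite -div1r ler_pdivlMr // mulrC -(ler_pM2l (exprn_gt0 3 phi0)) mulr1.
rewrite -hiff; split=> [->|h]; first by rewrite divff ?mulr1 // lt0r_neq0.
apply: (mulfI (lt0r_neq0 q0)); rewrite divff ?lt0r_neq0 //.
by apply: (mulfI (lt0r_neq0 (exprn_gt0 3 phi0))); rewrite h mulr1.
Qed.

Lemma interior_box_area B : maximal_interior_box lattice B -> area B = phi ^- q.
Proof.
move=> [he [pl pl1 [pl2 /andP[pl3 pl4]]] [pr pr1 [pr2 /andP[pr3 pr4]]]
   [pb pb1 [pb2 /andP[pb3 pb4]]] [pt pt1 [pt2 /andP[pt3 pt4]]]].
have [/box_set_in_square[l0 r1 b0 t1] _] := he.
have lr := box_lr B; have bt := box_bt B.
have [_ ->] := empty_box_area he.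
rewrite /zphi_touched /zphi_left /zphi_right.
split.
- have [|x [y [e1 e2]]] := mem_mod_fib_lattice_zphi pl1; first by right; lra.
  exists x, y; rewrite zphi_bottom_lt zphi_top_gt -e1 -e2 pl2.
  by rewrite !ltr_pM2r // pl3 pl4.
- have [|x [y [e1 e2]]] := mem_mod_fib_lattice_zphi pr1; first by right; lra.
  exists x, y; rewrite zphi_bottom_lt zphi_top_gt -e1 -e2 pr2.
  by rewrite !ltr_pM2r // pr3 pr4.
- have [|x [y [e1 e2]]] := mem_mod_fib_lattice_zphi pt1; first by left; lra.
  exists x, y; rewrite zphi_bottom_eq -e1 -e2 pt2.
  by rewrite !ltr_pM2r // pt3 pt4.
- have [|x [y [e1 e2]]] := mem_mod_fib_lattice_zphi pb1; first by left; lra.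
  exists x, y; rewrite zphi_top_eq -e1 -e2 pb2.
  by rewrite !ltr_pM2r // pb3 pb4.
Qed.

(** For the left, right and top edges, the touching element is prescribed in x or x', hence known
    exactly; the bottom edge is excluded by [zphi_low]. *)
Lemma zphi_touched_edge B : box_set B `<=` @unit_square R ->
  zphi_touched (zphi_left B) (zphi_right B) (zphi_bottom B) (zphi_top B) ->
  [/\ left_ B != 0, right_ B != 1, bottom_ B != 0 & top_ B != 1].
Proof.
move=> /box_set_in_square[l0 r1 b0 t1].
have lr := box_lr B; have bt := box_bt B.
have g := golden_gt32 R; have g2 := golden_lt2 R; have gs := golden_sqr R.
have /andP[s0 s1] := shift_bound R q.
have Lp : L * (phi - 1) = P by move: gs; rewrite expr2 => e; rewrite LE; ring: e.
case=> [[xl [yl [el hl]]] [xr [yr [er hr]]] [xt [yt [et ht]]] [xb [yb [eb hb]]]].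
move/zphi_bottom_eq: et => et; move/zphi_top_eq: eb => eb.
rewrite zphi_bottom_lt zphi_top_gt in hl; rewrite zphi_bottom_lt zphi_top_gt in hr.
move: el er hl hr ht hb; rewrite /zphi_left /zphi_right.
move=> el er /andP[l1 l2] /andP[r2 r3] /andP[t2 t3] /andP[b2 b3].
have lL : 0 <= left_ B * L by rewrite mulr_ge0 // ltW.
have bL : 0 <= bottom_ B * L by rewrite mulr_ge0 // ltW.
have rL : right_ B * L <= L by rewrite ler_piMl // ltW.
have tL : top_ B * L <= L by rewrite ler_piMl // ltW.
have low : phi - 1 <= bottom_ B * L.
  rewrite leNgt; apply/negP => h; apply: (@zphi_low R q xb yb).
    by apply/andP; split; lra.
  by rewrite eb; apply/andP; split; lra.
(* On the left edge the element is 0, of ordinate [shift], at most phi - 1 and so not above the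
   bottom side. *)
have left0 : left_ B != 0.
  apply/eqP => h; move: el; rewrite h mul0r => /zphi_eq0[a0 b0'].
  by move: l2; rewrite a0 b0' /zphi mul0r addr0 mulr0; lra.
split=> //.
(* On the right edge x = phi^(q+2), whose ordinate is phi - 1 for odd q and 0 for even q, again not
   above the bottom side. *)
- apply/eqP => h; move: er; rewrite h mul1r -zphi_golden_expr => e.
  have [xE yE] : xr - F2%:Z = 0 /\ yr - F1%:Z = 0.
    by apply: (@zphi_eq0 R); rewrite zphiB e subrr.
  move: r3; rewrite (subr0_eq xE) (subr0_eq yE).
  rewrite zphi_conj_expr [psi ^+ _]exprSr [P * (_ * psi)]mulrA conj_golden_expr -signr_odd /shift /=.
  by rewrite !negbK; move: low; case: (odd q) => /=; rewrite ?expr0 ?expr1; lra.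
- by apply/eqP => h; move: low; rewrite h mul0r; lra.
- apply/eqP => h; move: et; rewrite h mul1r /shift /= !negbK => et.
  have [oq|oq] := boolP (odd q); rewrite ?oq ?(negbTE oq) /= in et.
    (* On the top edge with q odd, x' = -phi and x = phi - 1. The element on the left side then has
       norm below 1, so it is 0, with ordinate 0. *)
    have [xE yE] : xt - 1 = 0 /\ yt - (-1) = 0.
      apply: (@zphi_conj_eq0 R); apply: (mulfI (lt0r_neq0 P0)).
      have -> : zphi psi (xt - 1) (yt - -1) = zphi psi xt yt + phi.
        by rewrite zphiB /zphi !mulrNz; ring.
      by rewrite mulr0 mulrDr; move: et; rewrite LE; lra.
    have xphi : zphi phi xt yt = phi - 1.
      by rewrite (subr0_eq xE) (subr0_eq yE) /zphi !mulrNz; ring.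
    have [a0 b0'] : xl = 0 /\ yl = 0.
      apply: (@zphi_norm_lt1 R); rewrite normrM el ger0_norm //.
      apply: le_lt_trans (_ : left_ B * L * phi < 1).
        apply: ler_wpM2l => //; rewrite -(ler_pM2l P0).
        rewrite -{1}(gtr0_norm P0) -normrM ler_norml [P * phi]mulrC -LE.
        by move: l1 l2; rewrite /shift /= !negbK oq /= => l1 l2; apply/andP; split; lra.
      have -> : 1 = (phi - 1) * phi by rewrite mulrBl -expr2 gs; ring.
      by rewrite ltr_pM2r // -xphi.
    by move: l2; rewrite a0 b0' /zphi mul0r addr0 mulr0 /shift /= !negbK oq /=; lra.
  (* With q even, x' = psi^(q+2) - phi, so x = phi^(q+2) + phi - 1 lies beyond the right edge. *)
  have [xE yE] : xt - (F2%:Z + 1) = 0 /\ yt - (F1%:Z - 1) = 0.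
    apply: (@zphi_conj_eq0 R); apply: (mulfI (lt0r_neq0 P0)).
    have -> : zphi psi (xt - (F2%:Z + 1)) (yt - (F1%:Z - 1)) =
        zphi psi xt yt - (psi ^+ q.+2 - phi).
      by rewrite zphiB -[F1%:Z - 1]/(F1%:Z + (-1)) zphiD zphi_conj_expr /zphi !mulrNz; ring.
    rewrite mulr0 mulrBr [P * (_ - _)]mulrBr [psi ^+ _]exprSr [P * (_ * psi)]mulrA conj_golden_expr.
    rewrite -signr_odd /= oq expr1; move: et; rewrite LE; lra.
  by move: t3; rewrite (subr0_eq xE) (subr0_eq yE) zphiD zphi_golden_expr /zphi !mulrNz; lra.
Qed.

Lemma exterior_box_area B : maximal_exterior_box lattice B -> area B < phi ^- q.
Proof.
move=> [he edge _ _ _]; have [hle hiff] := empty_box_area he.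
rewrite lt_neqAle hle andbT; apply/eqP => /hiff.
case/(zphi_touched_edge he.1) => n1 n2 n3 n4.
by case: edge => e; [move: n1|move: n2|move: n3|move: n4]; rewrite e eqxx.
Qed.

End BoxesInLattice.

(** * The dispersion *)

Section Dispersion.
Variables (R : realType) (q : nat).
Hypothesis q2 : (2 <= q)%N.
Local Notation phi := (golden R).
Local Notation psi := (1 - golden R).
Local Notation shift := (shift R q).
Local Notation L := (phi ^+ q.+2).
Local Notation P := (phi ^+ q.+1).
Local Notation lattice := (mod_fib_lattice R q.+3).

Lemma half_open_box_area (B : box R) : box_set B `<=` @unit_square R ->
  box_set B `&` [set` lattice] = set0 -> area B <= phi ^- q.
Proof.
move=> sub e; have [] // := @empty_box_area R q B.
split=> //; apply/seteqP; split=> // -[x y] [[hx hy] hp].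
rewrite -e; split=> //; move: hx hy; rewrite /= !in_itv /=.
by move=> /andP[/ltW h1 h2] /andP[/ltW h3 h4]; split; rewrite /= in_itv /= ?h1 ?h3.
Qed.

(* The four sides pass through the lattice points with abscissas phi, phi + phi,
   phi + phi^2 and phi + phi^3. *)
Lemma exists_extremal_box : exists B : box R,
  [/\ box_set B `<=` @unit_square R, box_interior B `&` [set` lattice] = set0 &
      area B = phi ^- q].
Proof.
have g := golden_gt32 R; have g2 := golden_lt2 R; have gs := golden_sqr R.
have phi0 : 0 < phi by lra.
have /andP[s0 s1] := shift_bound R q.
have P0 : 0 < P by apply: exprn_gt0.
have L0 : 0 < L by apply: exprn_gt0.
have LE : L = phi * P by rewrite exprS.
have g3 : phi ^+ 3 = 2 * phi + 1.
  by rewrite exprS gs; move: gs; rewrite expr2 => e; ring: e.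
(* The assumption m >= 5 enters here: phi^3 <= P makes the box fit into the square. *)
have P3 : 2 * phi + 1 <= P.
  by rewrite -g3; apply: ler_weXn2l; [lra|lia].
have lr : phi / L < (phi + phi ^+ 3) / L.
  by rewrite ltr_pM2r ?invr_gt0 // ltrDl exprn_gt0.
have bt : (shift + P * (2 * phi - 3)) / L < (shift + P * (2 * phi - 2)) / L.
  by rewrite ltr_pM2r ?invr_gt0 // ltrD2l ltr_pM2l //; lra.
exists (Box lr bt); split.
- apply/box_set_in_square; split=> /=.
  + by rewrite divr_ge0 // ltW.
  + rewrite ler_pdivrMr // mul1r LE g3; move: gs; rewrite expr2 => e; nra.
  + rewrite divr_ge0 //; last exact: ltW.
    by rewrite addr_ge0 // mulr_ge0 //; [exact: ltW|lra].
  + rewrite ler_pdivrMr // mul1r LE.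
    have : (2 * phi + 1) * (2 - phi) <= P * (2 - phi) by rewrite ler_pM2r //; lra.
    have -> : (2 * phi + 1) * (2 - phi) = phi by move: gs; rewrite expr2 => e; ring: e.
    by lra.
- apply/seteqP; split=> // -[x y] [] [] /=; rewrite !in_itv /=.
  rewrite !(ltr_pdivrMr _ _ L0) !(ltr_pdivlMr _ _ L0) => /andP[x0 x1] /andP[y0 y1] hp.
  have [|a [b [/= ex ey]]] := mem_mod_fib_lattice_zphi hp.
    by left; rewrite /= -(pmulr_lgt0 _ L0); lra.
  move: x0 x1 y0 y1; rewrite ex ey g3 => x0 x1 y0 y1.
  have {}y0 : zphi psi a b < 3 - 2 * phi by rewrite -(ltr_pM2l P0); lra.
  have {}y1 : 2 - 2 * phi < zphi psi a b by rewrite -(ltr_pM2l P0); lra.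
  (* Let z = (x - phi) / phi. Then 0 < z < phi^2 and psi < z' < 1, but each candidate 1, phi, phi^2
     from [zphi_small] violates one of these bounds. *)
  have aE : b + (a - 1 - b) = a - 1 by rewrite addrC subrK.
  have ez : phi * zphi phi b (a - 1 - b) = zphi phi a b - phi.
    by rewrite -(zphi_mul _ _ gs) aE /zphi intrB; ring.
  have ez' : psi * zphi psi b (a - 1 - b) = zphi psi a b - psi.
    by rewrite -(zphi_mul _ _ (psi_sqr R)) aE /zphi intrB; ring.
  have z0 : 0 < zphi phi b (a - 1 - b) by rewrite -(pmulr_rgt0 _ phi0) ez; lra.
  have z1 : zphi phi b (a - 1 - b) < phi ^+ 2.
    by rewrite -(ltr_pM2l phi0) ez -exprS g3; lra.
  have n0 : psi < 0 by lra.
  have y2 : zphi psi b (a - 1 - b) < 1 by rewrite -(ltr_nM2l n0) ez'; lra.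
  have y3 : psi < zphi psi b (a - 1 - b).
    by rewrite -(ltr_nM2l n0) ez' -expr2 psi_sqr; lra.
  case: (@zphi_small R b (a - 1 - b)); first by rewrite z0 ltW.
  + by rewrite ltr_norml; apply/andP; split; lra.
  + by move=> [e1 e2]; move: y2; rewrite e2 e1 /zphi; lra.
  + by move=> [e1 e2]; move: y3; rewrite e2 e1 /zphi; lra.
  + by move=> [e1 e2]; move: z1; rewrite e2 e1 /zphi gs; lra.
- rewrite /area /= -!mulrBl LE.
  have -> : phi + phi ^+ 3 - phi = phi ^+ 3 by ring.
  have -> : shift + P * (2 * phi - 2) - (shift + P * (2 * phi - 3)) = P by ring.
  have q0 : phi ^+ q != 0 by rewrite expf_neq0 // lt0r_neq0.
  by rewrite !exprS; field; rewrite q0 lt0r_neq0.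
Qed.

(** Half-open boxes include their left and bottom sides, so the extremal area is approached by
    moving these two sides inwards. *)
Lemma dispersion_mod_fib_lattice : dispersion lattice = phi ^- q.
Proof.
have [B [/box_set_in_square[l0 r1 b0 t1] e aB]] := exists_extremal_box.
have lr := box_lr B; have bt := box_bt B.
rewrite /dispersion; set S := [set area B | B in _].
have S_ub x : S x -> x <= phi ^- q.
  by case=> B' [sub e'] <-; apply: half_open_box_area.
have S_shrunk d : 0 < d -> d < right_ B - left_ B -> d < top_ B - bottom_ B ->
    S ((right_ B - left_ B - d) * (top_ B - bottom_ B - d)).
  move=> d0 dx dy.
  have lr' : left_ B + d < right_ B by lra.
  have bt' : bottom_ B + d < top_ B by lra.
  exists (Box lr' bt'); last by rewrite /area /= !opprD !addrA.
  split; first by apply/box_set_in_square; split=> /=; lra.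
  apply/seteqP; split=> // -[x y] [[hx hy] hp]; rewrite -e; split=> //.
  move: hx hy; rewrite /= !in_itv /= => /andP[x0 x1] /andP[y0 y1].
  by split; rewrite /= in_itv /=; apply/andP; split; lra.
have S_sup : has_sup S.
  split; last by exists (phi ^- q) => x /S_ub.
  pose d := Num.min (right_ B - left_ B) (top_ B - bottom_ B) / 2.
  exists ((right_ B - left_ B - d) * (top_ B - bottom_ B - d)).
  by apply: S_shrunk; rewrite /d; case: (ltP (right_ B - left_ B)) => ?; lra.
apply/eqP; rewrite eq_le; apply/andP; split.
  by apply: ge_sup => //; case: S_sup.
rewrite leNgt; apply/negP => lt_sup.
have a0 : 0 < phi ^- q - sup S by rewrite subr_gt0.
have aE : area B = (right_ B - left_ B) * (top_ B - bottom_ B) by [].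
have [d [d0 dx dy da]] : exists d, [/\ 0 < d, d < right_ B - left_ B,
    d < top_ B - bottom_ B & d < phi ^- q - sup S].
  exists (Num.min (Num.min (right_ B - left_ B) (top_ B - bottom_ B))
    (phi ^- q - sup S) / 2).
  have [] : Num.min (right_ B - left_ B) (top_ B - bottom_ B) <= right_ B - left_ B /\
      Num.min (right_ B - left_ B) (top_ B - bottom_ B) <= top_ B - bottom_ B.
    by rewrite !ge_min !lexx orbT.
  have : 0 < Num.min (right_ B - left_ B) (top_ B - bottom_ B).
    by rewrite lt_min !subr_gt0 lr bt.
  move: (Num.min (right_ B - left_ B) _) => u u0 u1 u2.
  by case: (ltP u (phi ^- q - sup S)) => ?; split; lra.
(* Side lengths are at most 1, so moving two sides by d / 2 costs less than d in area. *)
have d2 : 0 < d / 2 by lra.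
have := sup_upper_bound S_sup (S_shrunk _ d2 ltac:(lra) ltac:(lra)).
move: da lt_sup; rewrite -aB aE; nra.
Qed.

End Dispersion.

(** * Cardinality, Binet's formula and the limit *)

Lemma card_mod_fib_lattice (R : realType) q :
  #|` mod_fib_lattice R q.+3| = fib q.+3.
Proof.
rewrite card_in_imfset /=.
  by rewrite undup_id ?size_iota ?iota_uniq.
move=> k l _ _ []; rewrite lattice_lengthE => + _.
have L0 : golden R ^+ q.+2 != 0 by rewrite lt0r_neq0 // exprn_gt0 // golden_gt0.
move/(mulIf (invr_neq0 L0)) => e.
by case: (ltngtP k l) => // /(ltr_coord R q); rewrite e ltxx.
Qed.

Lemma sqrt5E (R : realType) : Num.sqrt 5 = 2 * golden R - 1.
Proof. by rewrite /golden; field. Qed.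

Lemma binet (R : realType) n :
  Num.sqrt 5 * (fib n)%:R = golden R ^+ n - (1 - golden R) ^+ n.
Proof.
by rewrite sqrt5E (expr_fib (golden_sqr R)) (expr_fib (psi_sqr R)); ring.
Qed.

(** Binet's formula leaves a geometric error term of ratio psi / phi. *)
Lemma normalized_dispersion (R : realType) q : (2 <= q)%N ->
  (#|` mod_fib_lattice R q.+3|)%:R * dispersion (mod_fib_lattice R q.+3) =
  golden R ^+ 3 / Num.sqrt 5
    - (1 - golden R) ^+ 3 / Num.sqrt 5 * ((1 - golden R) / golden R) ^+ q.
Proof.
move=> q2; rewrite card_mod_fib_lattice dispersion_mod_fib_lattice //.
have s0 : Num.sqrt 5 != 0 :> R by rewrite lt0r_neq0 // sqrtr_gt0.
have p0 : golden R ^+ q != 0 by rewrite expf_neq0 // lt0r_neq0 // golden_gt0.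
apply: (mulfI s0); rewrite mulrA binet [(_ / golden R) ^+ q]expr_div_n -[q.+3]/(3 + q)%N !exprD.
move: (golden R ^+ q) ((1 - golden R) ^+ q) p0 => x y x0.
by field; rewrite s0 x0.
Qed.

Theorem theorem1 (R : realType) :
  (forall m : nat, (5 <= m)%N ->
    [/\ forall B : box R, maximal_interior_box (mod_fib_lattice R m) B ->
          area B = golden R ^ (3 - m%:Z),
        forall B : box R, maximal_exterior_box (mod_fib_lattice R m) B ->
          area B < golden R ^ (3 - m%:Z) &
        dispersion (mod_fib_lattice R m) = golden R ^ (3 - m%:Z)])
  /\ (fun m : nat =>
        (#|` mod_fib_lattice R m|)%:R * dispersion (mod_fib_lattice R m))
       @ \oo --> golden R ^+ 3 / Num.sqrt 5
  /\ golden R ^+ 3 / Num.sqrt 5 = 1 + 2 / Num.sqrt 5.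
Proof.
have g := golden_gt32 R; have g2 := golden_lt2 R; have gs := golden_sqr R.
split; last split.
- case=> [//|[//|[//|q]]] q2.
  have -> : golden R ^ (3 - q.+3%:Z) = golden R ^- q.
    by rewrite exprnN; congr (_ ^ _); lia.
  split.
  + exact: interior_box_area.
  + exact: exterior_box_area.
  + exact: dispersion_mod_fib_lattice.
(* The shift makes m = (n + 2) + 3 at least 5, where the closed form holds. *)
- rewrite -(cvg_shiftn 5).
  have -> : (fun n => (#|` mod_fib_lattice R (n + 5)|)%:R *
      dispersion (mod_fib_lattice R (n + 5))) =
    (fun n => golden R ^+ 3 / Num.sqrt 5
      - (1 - golden R) ^+ 3 / Num.sqrt 5 * ((1 - golden R) / golden R) ^+ 2
        * ((1 - golden R) / golden R) ^+ n).
    apply/funext => n; have -> : (n + 5 = (n + 2).+3)%N by lia.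
    rewrite normalized_dispersion ?leq_addl // [_ ^+ (n + 2)]exprD.
    by rewrite [_ ^+ n * _]mulrC mulrA.
  have z1 : `|(1 - golden R) / golden R| < 1.
    rewrite ltr_norml; apply/andP; split.
      by rewrite ltr_pdivlMr ?golden_gt0 //; lra.
    by rewrite ltr_pdivrMr ?golden_gt0 //; lra.
  move: ((1 - golden R) / golden R) z1 => z z1.
  move: (golden R ^+ 3 / _) ((1 - golden R) ^+ 3 / _) => x y.
  have := cvgB (cvg_cst x) (cvgM (cvg_cst (y * z ^+ 2)) (cvg_expr z1)).
  by rewrite mulr0 subr0; apply.
- have s0 : Num.sqrt 5 != 0 :> R by rewrite lt0r_neq0 // sqrtr_gt0.
  apply: (mulIf s0); rewrite mulrDl !divfK // mul1r sqrt5E exprS gs.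
  by move: gs; rewrite expr2 => e; ring: e.
Qed.
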